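(* Let $\mathrm{Ch}(X_1,X_2,X_3)$ be a homogeneous $3$-chambar of degree $2$ on $\mathbb{C}^2$. Then, after a change of variables, $X_i$ can be written as $a_iy^2\frac{\partial}{\partial x}$ for $i=1,2,3$, where the constants $a_i$ satisfy $a_1+a_2+a_3=0$. In particular, any homogeneous $3$-chambar of degree $2$ on $\mathbb{C}^2$ is rigid.
   Context: For a holomorphic vector field $X$, $\exp(tX)$ denotes its local flow. A $p$-chambar $\mathrm{Ch}(X_1,\dots,X_p)$ is a set of $p$ distinct, not identically zero holomorphic vector fields $X_1,\dots,X_p$ satisfying the barycentric property: $\sum_{k=1}^p X_k(\exp(tX_k)(x))=0$ for all $x$ and all small $t\in\mathbb{C}$; equivalently $\sum_{k=1}^p\exp(tX_k)(x)=p\,x$. It is homogeneous of degree $\nu$ if every $X_i$ is homogeneous of degree $\nu$, i.e. its components are homogeneous polynomials of degree $\nu$. It is rigid if it has the form $\mathrm{Ch}(a_1X,\dots,a_pX)$ with $X$ a vector field and the $a_i$ constants. $(x,y)$ are coordinates on $\mathbb{C}^2$. *)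

(* Defs.v *)
From Stdlib Require Import Reals.
From Coquelicot Require Import Coquelicot.

Local Open Scope C_scope.

Definition C2 : NormedModule C_AbsRing :=
  prod_NormedModule C_AbsRing C_NormedModule C_NormedModule.

(* A vector field A d/dx + B d/dy is identified with the map (A, B). *)
Definition vfield := C2 -> C2.

(* Differentiability is C-linear here, since C2 is a module over C_AbsRing. *)
Definition holomorphic (X : vfield) : Prop :=
  forall z : C2, ex_filterdiff X (locally z).

Definition hom_poly (nu : nat) (P : C2 -> C) : Prop :=
  exists c : nat -> C, forall x y : C,
    P (x, y) = sum_n (fun i => c i * (x ^ i * y ^ (nu - i))) nu.

Definition homogeneous (nu : nat) (X : vfield) : Prop :=
  hom_poly nu (fun z => fst (X z)) /\ hom_poly nu (fun z => snd (X z)).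

(* [Phi t z] is exp(tX)(z).  It only has a meaning for t close to 0, in a
   neighbourhood that may depend on z; the values for other t are arbitrary. *)
Definition local_flow (X : vfield) (Phi : C -> C2 -> C2) : Prop :=
  forall z : C2,
    Phi 0 z = z /\
    locally (0 : C) (fun t : C =>
      is_derive (K := C_AbsRing) (V := C2) (fun s => Phi s z) t (X (Phi t z))).

(* For holomorphic fields the germ at t = 0 of a local flow exists and is
   unique, so it does not matter how [Phi] is chosen. *)
Definition barycentric (p : nat) (X : nat -> vfield) : Prop :=
  exists Phi : nat -> C -> C2 -> C2,
    (forall k, (1 <= k <= p)%nat -> local_flow (X k) (Phi k)) /\
    forall z : C2, locally (0 : C) (fun t : C =>
      sum_n_m (fun k => X k (Phi k t z)) 1 p = zero).

(* Only the fields X 1, ..., X p of the sequence X matter. *)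
Definition chambar (p : nat) (X : nat -> vfield) : Prop :=
  (forall k, (1 <= k <= p)%nat -> holomorphic (X k)) /\
  (forall k, (1 <= k <= p)%nat -> exists z : C2, X k z <> zero) /\
  (forall j k, (1 <= j <= p)%nat -> (1 <= k <= p)%nat -> j <> k ->
    exists z : C2, X j z <> X k z) /\
  barycentric p X.

Definition homogeneous_chambar (p nu : nat) (X : nat -> vfield) : Prop :=
  chambar p X /\ forall k, (1 <= k <= p)%nat -> homogeneous nu (X k).

Definition rigid (p : nat) (X : nat -> vfield) : Prop :=
  exists (Y : vfield) (a : nat -> C), holomorphic Y /\
    forall k, (1 <= k <= p)%nat -> forall z : C2, X k z = scal (a k) (Y z).

Definition linear_change (L : C2 -> C2) : Prop :=
  is_linear L /\
  exists M : C2 -> C2, (forall z, M (L z) = z) /\ (forall z, L (M z) = z).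

(* In the coordinates w = L z the field X is Y; as L is linear, it is its own
   differential. *)
Definition written_as (L : C2 -> C2) (X Y : vfield) : Prop :=
  forall z : C2, L (X z) = Y (L z).

Definition ay2dx (a : C) : vfield := fun z => (a * (snd z) ^ 2, RtoC 0).

(* Main.v *)
(* Expanding the barycentric identity at t = 0 gives, for the quadratic fields X_k
   seen as derivations, sum X_k = 0, sum X_k^2(id) = 0 and sum X_k^3(id) = 0.  With w a
   primitive cube root of 1, write X_1 = U + V, X_2 = w U + w^2 V, X_3 = w^2 U + w V.
   The last two identities then become (UV + VU)(id) = 0 and (U^3 + V^3)(id) = 0.
   If U(v) = l v with l <> 0, the first one makes V(v) either zero or an eigenvector of
   DU(v) for the opposite eigenvalue, and comparing coefficients in the basis (v, V(v))
   contradicts the second one.  So U and V vanish on each of their invariant lines; such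
   a line exists, being a zero of the cubic form x U_2 - y U_1.  Placing it on the first
   axis, the first identity forces one of U, V to be a multiple of y^2 d/dx, and then
   the other one too; if one of them is zero, V^3(id) = 0 makes V a nilpotent field
   y W, with the same conclusion. *)
Require Import Defs.
From Stdlib Require Import Reals Lra Lia Nsatz.
From Coquelicot Require Import Coquelicot.
From mathcomp Require bigop ssralg ssrnum complex Rstruct.

Local Open Scope C_scope.

(** * Complex numbers *)

(* A module, so that the MathComp notations and instances stay local. *)
Module CubicRoot.
Import ssralg ssrnum complex Rstruct.

(** The complex numbers that MathComp builds over [R] are algebraically closed; [F] and [G]
    translate between the two encodings by pairs, whose operations agree by computation. *)
Lemma monic_cubic_root (p q r : C) : exists x : C, x * (x * x) = p + q * x + r * (x * x).
Proof.
pose (F := fun z : C => complex.Complex (fst z) (snd z)).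
pose (G := fun z : complex.complex R => (complex.Re z, complex.Im z) : C).
destruct (@GRing.solve_monicpoly (complex.complex R) 3%nat
  (fun i => match i with 0%nat => F p | 1%nat => F q | _ => F r end) eq_refl) as [z H].
apply (f_equal G) in H. rewrite !bigop.big_ord_recl, bigop.big_ord0 in H.
assert (K : G z * (G z * G z) = p * 1 + (q * G z + (r * (G z * G z) + 0)))
  by (destruct z; exact H).
exists (G z). rewrite K. ring.
Qed.

End CubicRoot.

(** This instance and the next ones present [C] to [nsatz] as an integral domain. *)
#[global] Instance C_ops : @Ncring.Ring_ops C 0 1 Cplus Cmult Cminus Copp (@eq C).
Defined.

#[global] Instance C_ncring : Ncring.Ring (Ro := C_ops).
Proof.
constructor; try apply eq_equivalence;
  try (repeat intro; hnf in *; subst; reflexivity); intros; hnf; cbn; unfold equality.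
- apply Cplus_0_l.
- apply Cplus_comm.
- apply Cplus_assoc.
- apply Cmult_1_l.
- apply Cmult_1_r.
- apply Cmult_assoc.
- apply Cmult_plus_distr_r.
- apply Cmult_plus_distr_l.
- apply Cplus_opp_r.
Defined.

#[global] Instance C_cring : Cring.Cring (Rr := C_ncring).
Proof. exact Cmult_comm. Defined.

Lemma C_integral (x y : C) : x * y = 0 -> x = 0 \/ y = 0.
Proof.
intros H. destruct (Ceq_dec x 0) as [?|Hx]; [now left|right].
destruct (Ceq_dec y 0) as [?|Hy]; [easy|]. now destruct (Cmult_neq_0 x y).
Qed.

#[global] Instance C_integral_domain : Integral_domain.Integral_domain (Rcr := C_cring).
Proof. constructor. exact C_integral. exact C1_nz. Defined.

(* [nsatz] leaves a goal [c <> 0] for an integer constant c. *)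
Ltac NsatzTactic.nsatz_internal_discrR ::=
  let E := fresh in intro E; apply (f_equal fst) in E; simpl in E; lra.

Lemma Cmult_eq_reg (k x y : C) : k <> 0 -> k * x = k * y -> x = y.
Proof.
intros K H. destruct (C_integral k (x - y)) as [|E]; [nsatz|easy|]. nsatz.
Qed.

Lemma Cinv_neq_0 (x : C) : x <> 0 -> / x <> 0.
Proof. intros X E. apply C1_nz. rewrite <- (Cinv_r x X), E. ring. Qed.

Lemma RtoC_2 : RtoC 2 = 1 + 1.
Proof. rewrite <- RtoC_plus. f_equal; ring. Qed.

Lemma RtoC_3 : RtoC 3 = 1 + 1 + 1.
Proof. rewrite <- !RtoC_plus. f_equal; ring. Qed.

Lemma RtoC_4 : RtoC 4 = 1 + 1 + 1 + 1.
Proof. rewrite <- !RtoC_plus. f_equal; ring. Qed.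

(* [nsatz] does not know that numerals other than 0 and 1 are constants. *)
Ltac cnsatz := rewrite ?RtoC_2, ?RtoC_3, ?RtoC_4 in *; nsatz.

Lemma RtoC_neq_0 (r : R) : r <> 0%R -> RtoC r <> 0.
Proof. intros N E. now apply N, RtoC_inj. Qed.

Lemma scaled_cube_zero (r : R) (x : C) : r <> 0%R -> RtoC r * (x * x * x) = 0 -> x = 0.
Proof.
intros N E. destruct (C_integral _ _ E) as [Z|Z]; [now destruct (RtoC_neq_0 r N)|]. nsatz.
Qed.

(** A nonzero binary cubic vanishes on at most three lines; four are tested, through (1, 0), (0, 1),
    (1, 1) and (1, -1). *)
Lemma cubic_form_zero (c0 c1 c2 c3 : C) :
  (forall x y, c0 * (x * x * x) + c1 * (x * x * y) + c2 * (x * y * y) + c3 * (y * y * y) = 0) ->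
  c0 = 0 /\ c1 = 0 /\ c2 = 0 /\ c3 = 0.
Proof.
intros H.
assert (H0 : c0 = 0) by (rewrite <- (H 1 0); ring).
assert (H3 : c3 = 0) by (rewrite <- (H 0 1); ring).
assert (Hp := H 1 1). assert (Hm := H 1 (- (1))). clear H. subst c0 c3.
assert (Hp' : c1 + c2 = 0) by (rewrite <- Hp; ring).
assert (Hm' : c2 - c1 = 0) by (rewrite <- Hm; ring). clear Hp Hm.
repeat split; nsatz.
Qed.

(** The equation w^2 + w + 1 = 0 is oriented as a rewrite rule for [ring [Hw]]. *)
Lemma cube_root_of_unity : exists w : C, w * w = - (1) - w.
Proof.
exists (- (1 / 2), sqrt 3 / 2)%R.
assert (S := sqrt_sqrt 3 ltac:(lra)).
apply injective_projections; simpl; nra.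
Qed.

(** * Quadratic vector fields *)

Definition addv (v w : C * C) : C * C := (fst v + fst w, snd v + snd w).
Definition scalev (k : C) (v : C * C) : C * C := (k * fst v, k * snd v).
Definition zerov : C * C := (RtoC 0, RtoC 0).
Definition det (v w : C * C) : C := fst v * snd w - snd v * fst w.

(* The quadratic vector field X v = bil b v v is stored through its polarization. *)
Record sym_bil := SymBil { xx : C * C; xy : C * C; yy : C * C }.

Definition bil (b : sym_bil) (v w : C * C) : C * C :=
  addv (scalev (fst v * fst w) (xx b))
     (addv (scalev (fst v * snd w + snd v * fst w) (xy b)) (scalev (snd v * snd w) (yy b))).

(* For X v = bil b v v one has X^2(id) v = 2 bil b v (X v) and X^3(id) v = 2 jet3 b v. *)
Definition jet3 (b : sym_bil) (v : C * C) : C * C :=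
  addv (scalev 2 (bil b v (bil b v (bil b v v)))) (bil b (bil b v v) (bil b v v)).

(** Half of (UV + VU)(id) = 0; [order3] is likewise half of (U^3 + V^3)(id) = 0. *)
Definition order2 (b c : sym_bil) : Prop :=
  forall v, addv (bil b v (bil c v v)) (bil c v (bil b v v)) = zerov.

Definition order3 (b c : sym_bil) : Prop := forall v, addv (jet3 b v) (jet3 c v) = zerov.

Definition zero_spectrum (b : sym_bil) : Prop :=
  forall v l, bil b v v = scalev l v -> bil b v v = zerov.

(* The field u y^2 d/dx. *)
Definition shear (u : C) : sym_bil := SymBil zerov zerov (u, RtoC 0).

Ltac pairs := repeat match goal with z : (C * C)%type |- _ => destruct z as [? ?]
  | z : sym_bil |- _ => destruct z as [? ? ?] end.

Definition combine (e f z : C * C) : C * C := addv (scalev (fst z) e) (scalev (snd z) f).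
(** Cramer's rule: the inverse of [combine e f]. *)
Definition coords (e f w : C * C) : C * C := (det w f / det e f, det e w / det e f).

Definition in_frame (e f : C * C) (b : sym_bil) : sym_bil :=
  SymBil (coords e f (bil b e e)) (coords e f (bil b e f)) (coords e f (bil b f f)).

Ltac expand := intros; pairs; unfold in_frame, coords, combine, bil, addv, scalev, det, zerov in *;
  cbn [fst snd xx xy yy] in *.

Lemma bil_pair (a1 a2 b1 b2 p1 p2 x y x' y' : C) :
  bil (SymBil (a1, a2) (b1, b2) (p1, p2)) (x, y) (x', y') =
  (a1 * (x * x') + b1 * (x * y' + y * x') + p1 * (y * y'),
   a2 * (x * x') + b2 * (x * y' + y * x') + p2 * (y * y')).
Proof. expand. f_equal; ring. Qed.

Lemma bil_sym b v w : bil b v w = bil b w v.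
Proof. expand. f_equal; ring. Qed.

(* The coefficients of x^3, x^2 y, x y^2 and y^3 in both components. *)
Lemma order2_coefs (a1 a2 b1 b2 p1 p2 d1 d2 e1 e2 q1 q2 : C) :
  order2 (SymBil (a1, a2) (b1, b2) (p1, p2)) (SymBil (d1, d2) (e1, e2) (q1, q2)) ->
  (d1 * a1 + d2 * b1 + a1 * d1 + a2 * e1 = 0 /\
   d1 * b1 + d2 * p1 + 2 * (e1 * a1 + e2 * b1) + a1 * e1 + a2 * q1 + 2 * (b1 * d1 + b2 * e1) = 0 /\
   2 * (e1 * b1 + e2 * p1) + q1 * a1 + q2 * b1 + 2 * (b1 * e1 + b2 * q1) + p1 * d1 + p2 * e1 = 0 /\
   q1 * b1 + q2 * p1 + p1 * e1 + p2 * q1 = 0) /\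
  (d1 * a2 + d2 * b2 + a1 * d2 + a2 * e2 = 0 /\
   d1 * b2 + d2 * p2 + 2 * (e1 * a2 + e2 * b2) + a1 * e2 + a2 * q2 + 2 * (b1 * d2 + b2 * e2) = 0 /\
   2 * (e1 * b2 + e2 * p2) + q1 * a2 + q2 * b2 + 2 * (b1 * e2 + b2 * q2) + p1 * d2 + p2 * e2 = 0 /\
   q1 * b2 + q2 * p2 + p1 * e2 + p2 * q2 = 0).
Proof.
intros H; split; apply cubic_form_zero; intros x y;
  [rewrite <- (f_equal fst (H (x, y)) : _ = RtoC 0) | rewrite <- (f_equal snd (H (x, y)) : _ = RtoC 0)];
  unfold bil, addv, scalev; cbn [fst snd xx xy yy]; ring.
Qed.

(** * Exclusion of nonzero eigenvalues, and fields expressed in a frame *)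

Ltac bil_is E v w u :=
  match type of E with context [bil ?b v w] =>
    replace (bil b v w) with u in E by (unfold bil, addv, scalev; cbn [fst snd xx xy yy]; f_equal; ring)
  end.

(** The basis is (v, V(v)), with v scaled so that U(v) = v. *)
Lemma no_eigenvalue_coords (a b p q r s m n : C) :
  order2 (SymBil (RtoC 1, RtoC 0) (a, b) (p, q)) (SymBil (RtoC 0, RtoC 1) (r, s) (m, n)) ->
  order3 (SymBil (RtoC 1, RtoC 0) (a, b) (p, q)) (SymBil (RtoC 0, RtoC 1) (r, s) (m, n)) -> False.
Proof.
intros H2 H3.
(* The third-order identity is needed at v only; [L1] and [L2] are its two components. *)
assert (E := H3 (RtoC 1, RtoC 0)). unfold jet3 in E. clear H3.
do 3 (bil_is E (RtoC 1, RtoC 0) (RtoC 1, RtoC 0) (RtoC 1, RtoC 0)).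
bil_is E (RtoC 1, RtoC 0) (RtoC 1, RtoC 0) (RtoC 0, RtoC 1).
bil_is E (RtoC 1, RtoC 0) (RtoC 0, RtoC 1) (r, s).
bil_is E (RtoC 1, RtoC 0) (r, s) (s * r, r + s * s).
bil_is E (RtoC 0, RtoC 1) (RtoC 0, RtoC 1) (m, n).
assert (L1 : 3 + 2 * s * r + m = 0)
  by (rewrite <- (f_equal fst E : _ = RtoC 0); cbn [fst snd addv scalev]; ring).
assert (L2 : 2 * (r + s * s) + n = 0)
  by (rewrite <- (f_equal snd E : _ = RtoC 0); cbn [fst snd addv scalev]; ring).
clear E.
(* The coefficients of x^3, x^2 y and x y^2 express all unknowns through r and s. Then [L1] gives r
   s = -1, [L2] gives r = -5 s^2 and [B3] gives 18 s^3 = 8 r s, which are incompatible. *)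
apply order2_coefs in H2. destruct H2 as [[A0 [A1 [A2 A3]]] [B0 [B1 [B2 B3]]]].
assert (a = 0) by (rewrite <- A0; ring).
assert (b = - (1)) by (clear - B0; cnsatz). subst a b. clear A0 B0.
assert (p = - r) by (clear - A1; cnsatz).
assert (q = 3 * s) by (clear - B1; cnsatz). subst p q.
assert (m = r * s) by (clear - A2; cnsatz).
assert (n = 3 * s * s - r) by (clear - B2; cnsatz). subst m n.
assert (r * s = - (1)) by (clear - L1; cnsatz).
apply C1_nz; clear - H L2 B3; cnsatz.
Qed.

Lemma combine_coords e f w : det e f <> 0 -> combine e f (coords e f w) = w.
Proof. expand. f_equal; field; assumption. Qed.

Lemma coords_combine e f z : det e f <> 0 -> coords e f (combine e f z) = z.
Proof. expand. f_equal; field; assumption. Qed.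

Lemma coords_addv e f v w : coords e f (addv v w) = addv (coords e f v) (coords e f w).
Proof. expand. unfold Cdiv. f_equal; ring. Qed.

Lemma coords_scalev e f k v : coords e f (scalev k v) = scalev k (coords e f v).
Proof. expand. unfold Cdiv. f_equal; ring. Qed.

Lemma coords_zero e f : coords e f zerov = zerov.
Proof. expand. unfold Cdiv. f_equal; ring. Qed.

Lemma combine_scalev e f k v : combine e f (scalev k v) = scalev k (combine e f v).
Proof. expand. f_equal; ring. Qed.

Lemma bil_scalev_l b k v w : bil b (scalev k v) w = scalev k (bil b v w).
Proof. expand. f_equal; ring. Qed.

Lemma bil_scalev_r b k v w : bil b v (scalev k w) = scalev k (bil b v w).
Proof. expand. f_equal; ring. Qed.

Lemma bil_zero_r b v : bil b v zerov = zerov.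
Proof. expand. f_equal; ring. Qed.

Lemma bil_in_frame e f b v w :
  bil (in_frame e f b) v w = coords e f (bil b (combine e f v) (combine e f w)).
Proof. expand. unfold Cdiv. f_equal; ring. Qed.

Lemma order2_in_frame e f b c :
  det e f <> 0 -> order2 b c -> order2 (in_frame e f b) (in_frame e f c).
Proof.
intros D H v. rewrite !bil_in_frame, !combine_coords by exact D.
rewrite <- coords_addv, H. apply coords_zero.
Qed.

Lemma order3_in_frame e f b c :
  det e f <> 0 -> order3 b c -> order3 (in_frame e f b) (in_frame e f c).
Proof.
intros D H v. unfold jet3. rewrite !bil_in_frame, !combine_coords by exact D.
rewrite <- !coords_scalev, <- !coords_addv. rewrite <- (coords_zero e f). f_equal.
exact (H (combine e f v)).
Qed.

Lemma zero_spectrum_in_frame e f b :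
  det e f <> 0 -> zero_spectrum b -> zero_spectrum (in_frame e f b).
Proof.
intros D H v l E. rewrite bil_in_frame in *.
rewrite (H (combine e f v) l). apply coords_zero.
rewrite <- combine_scalev, <- E. symmetry. now apply combine_coords.
Qed.

Lemma in_frame_in_frame e f e' f' b : det e f <> 0 -> det e' f' <> 0 ->
  det (combine e f e') (combine e f f') <> 0 /\
  in_frame (combine e f e') (combine e f f') b = in_frame e' f' (in_frame e f b).
Proof.
intros D D'.
(* Multiplicativity of the determinant. *)
assert (E : det (combine e f e') (combine e f f') = det e f * det e' f') by (expand; ring).
assert (D2 : det (combine e f e') (combine e f f') <> 0) by (rewrite E; now apply Cmult_neq_0).
split; [exact D2|].
assert (K : forall w, coords (combine e f e') (combine e f f') w = coords e' f' (coords e f w)).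
{ intros w. rewrite <- (combine_coords e f w D) at 1. generalize (coords e f w) as z. intros z.
  rewrite <- (combine_coords e' f' z D') at 1. generalize (coords e' f' z) as y. intros y.
  replace (combine e f (combine e' f' y)) with (combine (combine e f e') (combine e f f') y)
    by (expand; f_equal; ring).
  now apply coords_combine. }
unfold in_frame at 1 2. rewrite !K, !bil_in_frame. reflexivity.
Qed.

Lemma parallel v w : v <> zerov -> det v w = 0 -> exists l, w = scalev l v.
Proof.
destruct v as [x y], w as [x' y']. intros N D. unfold det, scalev, zerov in *. cbn [fst snd] in *.
destruct (Ceq_dec x 0) as [->|Hx].
- destruct (Ceq_dec y 0) as [->|Hy]; [now destruct N|].
  exists (y' / y). assert (x' = 0) by (clear N; apply (Cmult_eq_reg y); [exact Hy | nsatz]).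
  subst. f_equal; field; exact Hy.
- exists (x' / x). f_equal; [field; exact Hx|].
  apply (Cmult_eq_reg x); [exact Hx|]. replace (x * (x' / x * y)) with (y * x') by (field; exact Hx).
  nsatz.
Qed.

Lemma scalev_eq_zero k v : v <> zerov -> scalev k v = zerov -> k = 0.
Proof.
destruct v as [x y]. intros N E.
destruct (Ceq_dec k 0) as [|K]; [easy|]. destruct N.
assert (E1 := f_equal fst E : k * x = 0). assert (E2 := f_equal snd E : k * y = 0).
unfold zerov. f_equal; [destruct (C_integral _ _ E1)|destruct (C_integral _ _ E2)]; easy.
Qed.

Lemma no_eigenvalue b c v l :
  order2 b c -> order3 b c -> v <> zerov -> bil b v v = scalev l v -> l = 0.
Proof.
intros H2 H3 N E. destruct (Ceq_dec l 0) as [|L]; [easy|]. exfalso.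
(* Since U is quadratic, dividing v by its eigenvalue makes the eigenvalue 1. *)
set (w := scalev (/ l) v).
assert (Ew : bil b w w = w).
{ unfold w. rewrite bil_scalev_l, bil_scalev_r, E. destruct v.
  unfold scalev. cbn [fst snd]. f_equal; field; exact L. }
assert (Nw : w <> zerov).
{ intros Z. destruct (Cinv_neq_0 l L). now apply (scalev_eq_zero _ v). }
clearbody w. clear v N E.
destruct (Ceq_dec (det w (bil c w w)) 0) as [D|D].
(* If V(w) = m w, the second-order identity reads 2 m w = 0, and the third-order one then reads 3 w
   = 0. *)
- destruct (parallel w _ Nw D) as [m Em].
  assert (m = 0).
  { specialize (H2 w). rewrite Ew, Em, bil_scalev_r, Ew in H2.
    assert (K : scalev (2 * m) w = zerov) by (rewrite <- H2; expand; f_equal; ring).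
    apply scalev_eq_zero in K; [|exact Nw]. cnsatz. }
  subst m. replace (scalev 0 w) with zerov in Em by (expand; f_equal; ring).
  specialize (H3 w). unfold jet3 in H3. rewrite !Ew, !Em, !bil_zero_r in H3.
  assert (K : scalev 3 w = zerov) by (rewrite <- H3; expand; f_equal; ring).
  apply scalev_eq_zero in K; [|exact Nw]. apply RtoC_inj in K. lra.
- apply (order2_in_frame _ _ _ _ D) in H2. apply (order3_in_frame _ _ _ _ D) in H3.
  unfold in_frame in H2, H3. rewrite Ew in H2, H3.
  replace (coords w (bil c w w) w) with (RtoC 1, RtoC 0) in H2, H3
    by (revert D; generalize (bil c w w); expand; f_equal; field; assumption).
  replace (coords w (bil c w w) (bil c w w)) with (RtoC 0, RtoC 1) in H2, H3
    by (revert D; generalize (bil c w w); expand; f_equal; field; assumption).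
  repeat match type of H2 with context [coords w ?a ?z] => destruct (coords w a z) end.
  exact (no_eigenvalue_coords _ _ _ _ _ _ _ _ H2 H3).
Qed.

Lemma order2_sym b c : order2 b c -> order2 c b.
Proof. intros H v. rewrite <- (H v). expand. f_equal; ring. Qed.

Lemma order3_sym b c : order3 b c -> order3 c b.
Proof. intros H v. rewrite <- (H v). unfold addv. f_equal; ring. Qed.

Lemma order23_zero_spectrum b c : order2 b c -> order3 b c -> zero_spectrum b.
Proof.
intros H2 H3 v l E.
assert (V : v = zerov \/ v <> zerov).
{ destruct v as [x y]. unfold zerov. destruct (Ceq_dec x 0) as [->|]; [destruct (Ceq_dec y 0) as [->|]|];
  [now left|right|right]; congruence. }
destruct V as [->|N]; [apply bil_zero_r|].
rewrite E, (no_eigenvalue b c v l H2 H3 N E). expand. f_equal; ring.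
Qed.

(** * Simultaneous reduction to multiples of y^2 d/dx *)

Definition simultaneous_shear (b c : sym_bil) : Prop :=
  exists e f u v, det e f <> 0 /\ in_frame e f b = shear u /\ in_frame e f c = shear v.

Lemma simultaneous_shear_sym b c : simultaneous_shear b c -> simultaneous_shear c b.
Proof. intros (e & f & u & v & D & B & C). exists e, f, v, u. tauto. Qed.

Lemma simultaneous_shear_in_frame e f b c :
  det e f <> 0 -> simultaneous_shear (in_frame e f b) (in_frame e f c) -> simultaneous_shear b c.
Proof.
intros D (e' & f' & u & v & D' & B & C).
destruct (in_frame_in_frame e f e' f' b D D') as [D2 Eb].
destruct (in_frame_in_frame e f e' f' c D D') as [_ Ec].
exists (combine e f e'), (combine e f f'), u, v. rewrite Eb, Ec. tauto.
Qed.

Lemma simultaneous_shear_shear u v : simultaneous_shear (shear u) (shear v).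
Proof.
exists (RtoC 1, RtoC 0), (RtoC 0, RtoC 1), u, v.
assert (N : forall w, in_frame (RtoC 1, RtoC 0) (RtoC 0, RtoC 1) (shear w) = shear w).
{ intros w. unfold shear. expand. f_equal; f_equal; field; exact C1_nz. }
rewrite !N. repeat split. unfold det. cbn [fst snd].
intros E. apply C1_nz. nsatz.
Qed.

(** Without an x^3 term the form vanishes at (1, 0); otherwise it is monic up to a factor on the
    line y = 1. *)
Lemma binary_cubic_root (c0 c1 c2 c3 : C) : exists x y : C, (x, y) <> zerov /\
  c0 * (x * x * x) + c1 * (x * x * y) + c2 * (x * y * y) + c3 * (y * y * y) = 0.
Proof.
destruct (Ceq_dec c0 0) as [->|N].
- exists 1, 0. split; [|ring]. intros E. exact (C1_nz (f_equal fst E)).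
- destruct (CubicRoot.monic_cubic_root (- (c3 / c0)) (- (c2 / c0)) (- (c1 / c0))) as [x E].
  exists x, 1. split; [intros F; exact (C1_nz (f_equal snd F))|].
  replace (x * x * x) with (x * (x * x)) by ring. rewrite E. field. exact N.
Qed.

Lemma frame_extends v : v <> zerov -> exists f, det v f <> 0.
Proof.
destruct v as [x y]. intros N. destruct (Ceq_dec x 0) as [->|X].
- exists (- RtoC 1, RtoC 0). intros E. apply N. unfold zerov, det in *. f_equal.
  cbn [fst snd] in E. clear N. nsatz.
- exists (RtoC 0, RtoC 1). intros E. apply X. unfold det in *. cbn [fst snd] in E. nsatz.
Qed.

Lemma zero_line b : zero_spectrum b -> exists e f, det e f <> 0 /\ xx (in_frame e f b) = zerov.
Proof.
intros V. destruct b as [[a1 a2] [b1 b2] [p1 p2]].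
(* These are the coefficients of x U_2 - y U_1, whose zeros span the invariant lines of U. *)
destruct (binary_cubic_root a2 (2 * b2 - a1) (p2 - 2 * b1) (- p1)) as (x & y & N & E).
destruct (frame_extends _ N) as [f D]. exists (x, y), f. split; [exact D|].
destruct (parallel (x, y) (bil (SymBil (a1, a2) (b1, b2) (p1, p2)) (x, y) (x, y)) N) as [l L].
- rewrite <- E. expand. ring.
- unfold in_frame. cbn [xx]. rewrite (V _ l L). apply coords_zero.
Qed.

(* (q1, q2) is itself an eigenvector, with eigenvalue q2^2. *)
Lemma zero_spectrum_square (q1 q2 : C) : zero_spectrum (SymBil zerov zerov (q1, q2)) -> q2 = 0.
Proof.
intros V. specialize (V (q1, q2) (q2 * q2)).
assert (E := f_equal snd (V ltac:(expand; f_equal; ring)) : _ = RtoC 0).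
apply (scaled_cube_zero 1); [lra|]. rewrite <- E. expand. ring.
Qed.

(** The second-order identity leaves only V = (q1 y^2 - 2 q2 x y, q2 y^2), which has a nonzero
    eigenvalue unless q2 = 0. *)
Lemma shear_propagates (p : C) c :
  p <> 0 -> order2 (shear p) c -> zero_spectrum c -> exists g, c = shear g.
Proof.
destruct c as [[d1 d2] [e1 e2] [q1 q2]]. intros P H V.
apply order2_coefs in H. destruct H as [[_ [A1 [A2 A3]]] [_ [_ [_ B3]]]].
assert (d2 = 0) by (apply (Cmult_eq_reg p); [exact P|]; clear - A1; nsatz). subst d2.
assert (e2 = 0) by (apply (Cmult_eq_reg p); [exact P|]; clear - B3; nsatz). subst e2.
assert (d1 = 0) by (apply (Cmult_eq_reg p); [exact P|]; clear - A2; cnsatz). subst d1.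
assert (e1 = - q2) by (apply (Cmult_eq_reg p); [exact P|]; clear - A3; nsatz). subst e1.
clear A1 A2 A3 B3.
(* (q1, 3 q2) is an eigenvector of c with eigenvalue 3 q2^2. *)
specialize (V (q1, 3 * q2) (3 * q2 * q2)).
assert (E := f_equal snd (V ltac:(expand; f_equal; ring)) : _ = RtoC 0).
assert (Q : q2 = 0).
{ assert (E' : 9 * (q2 * q2 * q2) = 0) by (rewrite <- E; expand; ring).
  apply (scaled_cube_zero 9); [lra|exact E']. }
subst q2. exists q1. unfold shear, zerov. repeat f_equal; ring.
Qed.

(** The coefficient of x y^2 in the first component is e1 (4 b1 + p2): either [c] is already a
    shear, or p2 = -4 b1 and the spectral condition forces b1 = 0. *)
Lemma common_zero_aux (b1 p1 p2 e1 q1 : C) :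
  let b := SymBil zerov (b1, RtoC 0) (p1, p2) in let c := SymBil zerov (e1, RtoC 0) (q1, RtoC 0) in
  order2 b c -> zero_spectrum b -> exists g, b = shear g \/ c = shear g.
Proof.
intros b c H V. apply order2_coefs in H. destruct H as [[_ [_ [A _]]] _].
destruct (Ceq_dec e1 0) as [Z|N]; [exists q1; right; unfold c; now rewrite Z|].
exists p1; left.
assert (P : p2 = - (4) * b1) by (apply (Cmult_eq_reg e1); [exact N|]; clear - A; cnsatz).
subst p2. subst b. clear - V.
(* (- p1, 6 b1) is an eigenvector of b with eigenvalue - 24 b1^2. *)
specialize (V (- p1, 6 * b1) (- (24) * b1 * b1)).
assert (E := f_equal snd (V ltac:(expand; f_equal; ring)) : _ = RtoC 0).
assert (Q : b1 = 0).
{ assert (E' : 144 * (b1 * b1 * b1) = 0) by (rewrite <- (Cmult_0_r (- (1))), <- E; expand; ring).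
  apply (scaled_cube_zero 144); [lra|exact E']. }
subst b1. unfold shear, zerov. repeat f_equal; ring.
Qed.

(** The identity gives b2 e2 = 0 and e2 b1 + b2 e1 = 0. If b2 or e2 is nonzero, the other field is a
    constant vector times y^2, hence a shear; if both vanish, p2 q2 = 0 leads to
    [common_zero_aux]. *)
Lemma common_zero b c :
  order2 b c -> zero_spectrum b -> zero_spectrum c -> xx b = zerov -> xx c = zerov ->
  exists g, b = shear g \/ c = shear g.
Proof.
destruct b as [a [b1 b2] [p1 p2]], c as [d [e1 e2] [q1 q2]]. cbn [xx].
intros H Vb Vc -> ->. assert (H' := H). apply order2_coefs in H'.
destruct H' as [[_ [A1 _]] [_ [B1 [_ B3]]]].
assert (BE : b2 * e2 = 0) by (clear - B1; cnsatz).
assert (A : e2 * b1 + b2 * e1 = 0) by (clear - A1; cnsatz). clear A1 B1.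
destruct (Ceq_dec b2 0) as [->|N].
- destruct (Ceq_dec e2 0) as [->|N].
  + assert (Q : q2 * p2 = 0) by (clear - B3; cnsatz).
    destruct (C_integral _ _ Q) as [->| ->].
    * now apply common_zero_aux.
    * destruct (common_zero_aux e1 q1 q2 b1 p1) as [g [G|G]]; try exact Vc;
      [now apply order2_sym|exists g; now right|exists g; now left].
  + assert (b1 = 0) by (apply (Cmult_eq_reg e2); [exact N|]; clear - A; nsatz). subst b1.
    exists p1. left. unfold shear. now rewrite (zero_spectrum_square p1 p2 Vb).
- assert (e2 = 0) by (apply (Cmult_eq_reg b2); [exact N|]; clear - BE; nsatz). subst e2.
  assert (e1 = 0) by (apply (Cmult_eq_reg b2); [exact N|]; clear - A; nsatz). subst e1.
  exists q1. right. unfold shear. now rewrite (zero_spectrum_square q1 q2 Vc).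
Qed.

(** Once the first axis consists of zeros of V, the equation V^3(id) = 0 exhibits multiples of the
    cubes of b2, p2 and b1 in turn. *)
Lemma nilpotent_shear c : zero_spectrum c -> (forall v, jet3 c v = zerov) ->
  exists e f g, det e f <> 0 /\ in_frame e f c = shear g.
Proof.
intros V H. destruct (zero_line c V) as (e & f & D & Z).
exists e, f.
assert (H' : forall v, jet3 (in_frame e f c) v = zerov).
{ intros v. unfold jet3. rewrite !bil_in_frame, !combine_coords by exact D.
  rewrite <- !coords_scalev, <- !coords_addv, <- (coords_zero e f). f_equal.
exact (H (combine e f v)). }
clear H. revert Z H'. destruct (in_frame e f c) as [a [b1 b2] [p1 p2]]. cbn [xx]. intros -> H.
pose (F x y := snd (jet3 (SymBil zerov (b1, b2) (p1, p2)) (x, y))).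
assert (F0 : forall x y, F x y = 0) by (intros; unfold F; now rewrite H).
assert (B : b2 = 0).
{ assert (E : 48 * (b2 * b2 * b2) = 0).
  { (* This combination isolates the coefficient of x^3 y. *)
    transitivity (F 2 1 - F 2 (- (1)) - 2 * (F 1 1 - F 1 (- (1)))).
    - unfold F, jet3, zerov. rewrite !bil_pair. unfold addv, scalev. cbn [fst snd]. ring.
    - rewrite !F0. ring. }
  apply (scaled_cube_zero 48); [lra|exact E]. }
subst b2.
assert (Q : p2 = 0).
{ assert (E : 3 * (p2 * p2 * p2) = 0).
  { rewrite <- (F0 0 1). unfold F, jet3, zerov. rewrite !bil_pair. unfold addv, scalev. cbn [fst snd]. ring. }
  apply (scaled_cube_zero 3); [lra|exact E]. }
subst p2. clear F F0.
assert (b1 = 0).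
{ assert (E : 4 * (b1 * b1 * b1) = 0).
  (* The first component is now 2 b1^2 y^2 (2 b1 x y + p1 y^2); the difference keeps its x y^3
     term. *)
  { transitivity (fst (jet3 (SymBil zerov (b1, RtoC 0) (p1, RtoC 0)) (RtoC 1, RtoC 1)) -
                  fst (jet3 (SymBil zerov (b1, RtoC 0) (p1, RtoC 0)) (RtoC 0, RtoC 1))).
    - unfold jet3, zerov. rewrite !bil_pair. unfold addv, scalev. cbn [fst snd]. ring.
    - rewrite !H. cbn. ring. }
  apply (scaled_cube_zero 4); [lra|exact E]. }
subst b1. exists p1. split; [exact D|reflexivity].
Qed.

Lemma bil_shear0 v w : bil (shear 0) v w = zerov.
Proof. unfold shear. expand. f_equal; ring. Qed.

Lemma jet3_shear0 v : jet3 (shear 0) v = zerov.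
Proof. unfold jet3. rewrite !bil_shear0. expand. f_equal; ring. Qed.

Lemma addv_zero_l v : addv zerov v = v.
Proof. expand. f_equal; ring. Qed.

(** For p = 0 the third-order identity concerns [c] alone and any frame suits the zero field; for p
    <> 0 the given axes already work. *)
Lemma simultaneous_shear_of_shear p c :
  order2 (shear p) c -> order3 (shear p) c -> zero_spectrum c -> simultaneous_shear (shear p) c.
Proof.
intros H2 H3 V. destruct (Ceq_dec p 0) as [->|N].
- destruct (nilpotent_shear c V) as (e & f & g & D & E).
  { intros v. now rewrite <- (H3 v), jet3_shear0, addv_zero_l. }
  exists e, f, 0, g. split; [exact D|]. split; [|exact E].
  unfold shear. expand. unfold Cdiv. repeat f_equal; ring.
- destruct (shear_propagates p c N H2 V) as [g ->]. apply simultaneous_shear_shear.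
Qed.

Lemma simultaneous_shear_of_order23 b c : order2 b c -> order3 b c -> simultaneous_shear b c.
Proof.
intros H2 H3.
assert (Vb := order23_zero_spectrum b c H2 H3).
assert (Vc := order23_zero_spectrum c b (order2_sym _ _ H2) (order3_sym _ _ H3)).
destruct (zero_line b Vb) as (e & f & D & Z). apply (simultaneous_shear_in_frame e f); [exact D|].
apply (order2_in_frame e f _ _ D) in H2. apply (order3_in_frame e f _ _ D) in H3.
apply (zero_spectrum_in_frame e f _ D) in Vb. apply (zero_spectrum_in_frame e f _ D) in Vc.
revert H2 H3 Vb Vc Z. generalize (in_frame e f b) (in_frame e f c). clear.
intros b c H2 H3 Vb Vc Z.
(* U vanishes on the first axis. If that axis is also invariant under V, then V vanishes on it too;
   otherwise the x^3 coefficients d2 b1 and d2 b2 reduce U to a constant vector times y^2. *)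
destruct (Ceq_dec (snd (xx c)) 0) as [S|S].
- assert (Zc : xx c = zerov).
  { assert (E : bil c (RtoC 1, RtoC 0) (RtoC 1, RtoC 0) = xx c) by (clear; expand; f_equal; ring).
    rewrite <- E. apply (Vc _ (fst (xx c))). rewrite E. revert S. clear.
    destruct (xx c) as [d1 d2]. unfold scalev. cbn [fst snd]. intros ->. f_equal; ring. }
  destruct (common_zero b c H2 Vb Vc Z Zc) as [g [-> | ->]].
  + now apply simultaneous_shear_of_shear.
  + apply simultaneous_shear_sym, simultaneous_shear_of_shear;
      [now apply order2_sym|now apply order3_sym|exact Vb].
- enough (exists g, b = shear g) as [g ->] by now apply simultaneous_shear_of_shear.
  destruct b as [a [b1 b2] [p1 p2]], c as [[d1 d2] [e1 e2] [q1 q2]]. cbn [xx fst snd] in *. subst a.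
  apply order2_coefs in H2. destruct H2 as [[A0 _] [B0 _]].
  assert (b1 = 0) by (apply (Cmult_eq_reg d2); [exact S|]; clear - A0; nsatz). subst b1.
  assert (b2 = 0) by (apply (Cmult_eq_reg d2); [exact S|]; clear - B0; nsatz). subst b2.
  exists p1. unfold shear. now rewrite (zero_spectrum_square p1 p2 Vb).
Qed.

(** * Differentiating the barycentric identity *)

Local Notation CK := (AbsRing_NormedModule C_AbsRing).
Local Notation derive2 := (is_derive (K := C_AbsRing) (V := C2)).
Local Notation nearC := (locally (T := AbsRing_UniformSpace C_AbsRing)).

(* [C_NormedModule] and [CK] have the same norm but
   different uniform structures, so they are not convertible. *)
Lemma is_derive_C_AbsRing (f : C -> C) (t l : C) :
  is_derive (K := C_AbsRing) (V := C_NormedModule) f t l <->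
  is_derive (K := C_AbsRing) (V := CK) f t l.
Proof. split; intros [[P S N] H]; (split; [constructor; assumption | exact H]). Qed.

(** The Leibniz rule, from products of scalar components multiplied by the constant vectors of
    [b]. *)
Lemma is_derive_bil (b : sym_bil) (f g : C -> C2) (t : C) (df dg : C2) :
  derive2 f t df -> derive2 g t dg ->
  derive2 (fun s => bil b (f s) (g s)) t
    (addv (bil b df (g t)) (bil b (f t) dg)).
Proof.
intros Hf Hg.
assert (P : forall (h : C -> C2) dh, derive2 h t dh ->
  is_derive (K := C_AbsRing) (V := CK) (fun s => fst (h s)) t (fst dh) /\
  is_derive (K := C_AbsRing) (V := CK) (fun s => snd (h s)) t (snd dh)).
{ intros h dh H. split; apply is_derive_C_AbsRing.
  - exact (filterdiff_comp (U := CK) (V := C2) (W := C_NormedModule)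
      h fst _ fst H
      (filterdiff_linear _ is_linear_fst)).
  - exact (filterdiff_comp (U := CK) (V := C2) (W := C_NormedModule)
      h snd _ snd H
      (filterdiff_linear _ is_linear_snd)). }
destruct (P f df Hf) as [F1 F2]. destruct (P g dg Hg) as [G1 G2]. clear P Hf Hg.
assert (M : forall (h k : C -> C) (dh dk : C),
  is_derive (K := C_AbsRing) (V := CK) h t dh ->
  is_derive (K := C_AbsRing) (V := CK) k t dk ->
  is_derive (K := C_AbsRing) (V := CK) (fun s => h s * k s) t
    (dh * k t + h t * dk)).
{ intros h k dh dk Hh Hk. exact (is_derive_mult h k t dh dk Hh Hk Cmult_comm). }
assert (D1 := is_derive_scal_l (V := C2) _ _ _ (xx b : C2) (M _ _ _ _ F1 G1)).
assert (D2 := is_derive_scal_l (V := C2) _ _ _ (xy b : C2)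
  (is_derive_plus _ _ _ _ _ (M _ _ _ _ F1 G2) (M _ _ _ _ F2 G1))).
assert (D3 := is_derive_scal_l (V := C2) _ _ _ (yy b : C2) (M _ _ _ _ F2 G2)).
assert (D := is_derive_plus _ _ _ _ _ D1 (is_derive_plus _ _ _ _ _ D2 D3)).
match type of D with is_derive _ _ ?l =>
  replace (addv (bil b df (g t)) (bil b (f t) dg)) with (l : C * C) end.
- exact D.
- clear. destruct (f t) as [f1 f2], (g t) as [g1 g2], df as [df1 df2], dg as [dg1 dg2].
  change (@plus C2) with addv. change (@scal _ C2) with scalev.
  unfold bil, addv, scalev. cbn [fst snd].
  repeat match goal with |- context [@plus ?T ?x ?y] => change (@plus T x y) with (Cplus x y) end.
  f_equal; ring.
Qed.

Lemma is_derive_locally_zero (f : C -> C2) (t : C) (l : C2) :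
  nearC t (fun s => f s = zero) ->
  derive2 f t l -> l = zero.
Proof.
intros Z H.
assert (Hz : derive2 (fun _ => zero) t l)
  by exact (is_derive_ext_loc f _ t l Z H).
assert (H1 := filterdiff_comp (U := CK) (V := C2) (W := C_NormedModule)
      _ fst _ fst Hz
      (filterdiff_linear _ is_linear_fst)).
assert (H2 := filterdiff_comp (U := CK) (V := C2) (W := C_NormedModule)
      _ snd _ snd Hz
      (filterdiff_linear _ is_linear_snd)).
assert (U : forall d : C, is_derive (K := C_AbsRing) (V := C_NormedModule)
  (fun _ => RtoC 0) t d -> d = RtoC 0).
{ intros d Hd. rewrite <- (is_C_derive_unique _ _ _ Hd).
  exact (is_C_derive_unique _ _ _ (is_derive_const (V := C_NormedModule) (RtoC 0) t)). }
destruct l as [l1 l2]. rewrite (U l1 H1), (U l2 H2). reflexivity.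
Qed.

Lemma locally_and3 (T : UniformSpace) (t : T) (P : nat -> T -> Prop) :
  (forall k, (1 <= k <= 3)%nat -> locally t (P k)) ->
  locally t (fun s => forall k, (1 <= k <= 3)%nat -> P k s).
Proof.
intros H.
assert (H1 := H 1%nat ltac:(lia)). assert (H2 := H 2%nat ltac:(lia)).
assert (H3 := H 3%nat ltac:(lia)).
apply (filter_imp (fun s => P 1%nat s /\ P 2%nat s /\ P 3%nat s)).
- intros s (A1 & A2 & A3) [|[|[|[|k]]]] Hk; try lia; assumption.
- repeat apply filter_and; assumption.
Qed.

Definition sum3 (f : nat -> C * C) : C * C := addv (f 1%nat) (addv (f 2%nat) (f 3%nat)).

Lemma is_derive_sum3 (f : nat -> C -> C2) (t : C) (df : nat -> C2) :
  (forall k, (1 <= k <= 3)%nat -> derive2 (f k) t (df k)) ->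
  derive2 (fun s => sum3 (fun k => f k s)) t (sum3 df).
Proof.
intros H. apply (is_derive_plus (V := C2)); [|apply (is_derive_plus (V := C2))]; apply H; lia.
Qed.

(* The Taylor coefficients at t = 0 of the barycentric identity, up to order two. *)
Lemma barycentric_jet (X : nat -> vfield) (B : nat -> sym_bil) :
  (forall k, (1 <= k <= 3)%nat -> forall z, X k z = bil (B k) z z) ->
  barycentric 3 X ->
  forall z : C * C,
    sum3 (fun k => bil (B k) z z) = zerov /\
    sum3 (fun k => bil (B k) z (bil (B k) z z)) = zerov /\
    sum3 (fun k => jet3 (B k) z) = zerov.
Proof.
intros HX (Phi & Hflow & Hsum) z.
(* Along the flow line through z, [F0] is the first derivative and [F1] half of the second; [jet3]
   is the derivative of [F1]. *)
pose (F0 k s := bil (B k) (Phi k s z) (Phi k s z)).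
pose (F1 k s := bil (B k) (Phi k s z) (F0 k s)).
assert (Z0 : nearC (0 : C) (fun s => sum3 (fun k => F0 k s) = zerov)).
{ generalize (proj1 (locally_C _ _) (Hsum z)). apply filter_imp. intros s E.
  rewrite sum_Sn_m, sum_Sn_m, sum_n_n, !HX in E by lia. exact E. }
assert (DPhi : nearC (0 : C) (fun s => forall k, (1 <= k <= 3)%nat ->
  derive2 (fun r => Phi k r z) s (F0 k s))).
{ apply locally_and3. intros k Hk. generalize (proj1 (locally_C _ _) (proj2 (Hflow k Hk z))).
  apply filter_imp. intros s. unfold F0. now rewrite HX. }
assert (DF0 : nearC (0 : C) (fun s => forall k, (1 <= k <= 3)%nat ->
  derive2 (F0 k) s (scalev 2 (F1 k s)))).
{ revert DPhi. apply filter_imp. intros s H k Hk.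
  replace (scalev 2 (F1 k s)) with
    (addv (bil (B k) (F0 k s) (Phi k s z)) (bil (B k) (Phi k s z) (F0 k s))).
  - exact (is_derive_bil (B k) _ _ s _ _ (H k Hk) (H k Hk)).
  - unfold F1. rewrite (bil_sym _ (F0 k s)). unfold addv, scalev. f_equal; ring. }
assert (Z1 : nearC (0 : C) (fun s => sum3 (fun k => F1 k s) = zerov)).
(* [Z0] holds around every time close to 0, so it can be differentiated at each of them and not only
   at 0. *)
{ generalize (filter_and _ _ (locally_locally _ _ Z0) DF0). apply filter_imp. intros s [Z D].
  assert (E := is_derive_locally_zero _ _ _ Z (is_derive_sum3 _ _ _ D)).
  unfold sum3, addv, scalev in *. cbn [fst snd] in *.
  unfold zerov. f_equal; apply (Cmult_eq_reg 2); try (apply RtoC_neq_0; lra).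
  - rewrite Cmult_0_r, <- (f_equal fst E : _ = RtoC 0). cbn [fst snd]. ring.
  - rewrite Cmult_0_r, <- (f_equal snd E : _ = RtoC 0). cbn [fst snd]. ring. }
assert (DF1 : forall k, (1 <= k <= 3)%nat ->
  derive2 (F1 k) (RtoC 0) (jet3 (B k) (Phi k 0 z))).
{ intros k Hk.
  replace (jet3 (B k) (Phi k 0 z)) with
    (addv (bil (B k) (F0 k 0) (F0 k 0)) (bil (B k) (Phi k 0 z) (scalev 2 (F1 k 0)))).
  - exact (is_derive_bil (B k) _ _ _ _ _ (locally_singleton _ _ DPhi k Hk)
      (locally_singleton _ _ DF0 k Hk)).
  - unfold jet3. rewrite bil_scalev_r. unfold addv. f_equal; apply Cplus_comm. }
assert (Z2 := is_derive_locally_zero _ _ _ Z1 (is_derive_sum3 _ _ _ DF1)).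
apply locally_singleton in Z0, Z1. unfold sum3, F1, F0 in *.
rewrite !(fun k Hk => proj1 (Hflow k Hk z)) in Z0, Z1, Z2 by lia.
auto.
Qed.

(** * Splitting three fields by the cube roots of unity *)

Definition lincomb (k : C) (b : sym_bil) (l : C) (c : sym_bil) : sym_bil :=
  SymBil (addv (scalev k (xx b)) (scalev l (xx c))) (addv (scalev k (xy b)) (scalev l (xy c)))
       (addv (scalev k (yy b)) (scalev l (yy c))).

Lemma bil_lincomb k b l c v w :
  bil (lincomb k b l c) v w = addv (scalev k (bil b v w)) (scalev l (bil c v w)).
Proof. unfold lincomb. expand. f_equal; ring. Qed.

Lemma bil_addv_l b v v' w : bil b (addv v v') w = addv (bil b v w) (bil b v' w).
Proof. expand. f_equal; ring. Qed.

Lemma bil_addv_r b v w w' : bil b v (addv w w') = addv (bil b v w) (bil b v w').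
Proof. expand. f_equal; ring. Qed.

Lemma in_frame_lincomb e f k b l c :
  in_frame e f (lincomb k b l c) = lincomb k (in_frame e f b) l (in_frame e f c).
Proof.
unfold in_frame at 1. rewrite !bil_lincomb, !coords_addv, !coords_scalev. reflexivity.
Qed.

Lemma lincomb_shear k u l v : lincomb k (shear u) l (shear v) = shear (k * u + l * v).
Proof. unfold lincomb, shear. expand. f_equal; f_equal; ring. Qed.

(* [- (1) - w] stands for w^2. *)
Definition twisted (w : C) (u v : sym_bil) (k : nat) : sym_bil :=
  match k with
  | 1%nat => lincomb 1 u 1 v
  | 2%nat => lincomb w u (- (1) - w) v
  | _ => lincomb (- (1) - w) u w v
  end.

(** U carries 1, w, w^2 and V the inverse factors. As 1 + w + w^2 = 0, the sum cancels UU and VV and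
    keeps UV and VU three times. *)
Lemma twisted_order2 w u v : w * w = - (1) - w ->
  (forall z, sum3 (fun k => bil (twisted w u v k) z (bil (twisted w u v k) z z)) = zerov) -> order2 u v.
Proof.
intros Hw H z. specialize (H z). unfold sum3, twisted in H.
rewrite !bil_lincomb, !bil_addv_r, !bil_scalev_r in H.
revert H.
generalize (bil u z (bil u z z)) (bil u z (bil v z z)) (bil v z (bil u z z)) (bil v z (bil v z z)).
intros [a1 a2] [b1 b2] [c1 c2] [d1 d2] H.
assert (H1 := f_equal fst H : _ = RtoC 0). assert (H2 := f_equal snd H : _ = RtoC 0). clear H.
unfold addv, scalev, zerov in *. cbn [fst snd] in *.
f_equal; apply (Cmult_eq_reg 3); try (apply RtoC_neq_0; lra);
 [rewrite Cmult_0_r, <- H1|rewrite Cmult_0_r, <- H2]; ring [Hw].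
Qed.

(** Among words of length three only UUU and VVV carry a factor independent of k, namely 1; the
    mixed words cancel in the sum. *)
Lemma twisted_order3 w u v : w * w = - (1) - w ->
  (forall z, sum3 (fun k => jet3 (twisted w u v k) z) = zerov) -> order3 u v.
Proof.
intros Hw H z. specialize (H z). unfold sum3, twisted, jet3 in *.
repeat rewrite ?bil_lincomb, ?bil_addv_r, ?bil_scalev_r, ?bil_addv_l, ?bil_scalev_l in H.
rewrite ?(bil_sym _ (bil v z z) (bil u z z)) in H.
revert H.
(* With the fourteen distinct terms abstracted, a linear identity modulo the equation of w
   remains. *)
generalize (bil u (bil u z z) (bil u z z)) (bil u (bil u z z) (bil v z z))
  (bil u (bil v z z) (bil v z z))
  (bil v (bil u z z) (bil u z z)) (bil v (bil u z z) (bil v z z)) (bil v (bil v z z) (bil v z z))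
  (bil u z (bil u z (bil u z z))) (bil u z (bil u z (bil v z z)))
  (bil u z (bil v z (bil u z z))) (bil u z (bil v z (bil v z z)))
  (bil v z (bil u z (bil u z z))) (bil v z (bil u z (bil v z z)))
  (bil v z (bil v z (bil u z z))) (bil v z (bil v z (bil v z z))).
intros a b c d e f g h i j k l m n H.
assert (H1 := f_equal fst H : _ = RtoC 0). assert (H2 := f_equal snd H : _ = RtoC 0). clear H.
unfold addv, scalev, zerov in *. cbn [fst snd] in *.
f_equal; apply (Cmult_eq_reg 3); try (apply RtoC_neq_0; lra);
 [rewrite Cmult_0_r, <- H1|rewrite Cmult_0_r, <- H2]; ring [Hw].
Qed.

(** Inversion of the discrete Fourier transform of order three; its constant mode is absent because
    the fields sum to zero. *)
Lemma twisted_exists (w : C) (b c d : sym_bil) : w * w = - (1) - w ->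
  (forall z, addv (bil b z z) (addv (bil c z z) (bil d z z)) = zerov) ->
  exists u v, b = twisted w u v 1 /\ c = twisted w u v 2 /\ d = twisted w u v 3.
Proof.
intros Hw H.
(* This is w^2 - w, the determinant of the system for U and V; its square is -3. *)
assert (N : - (1) - w - w <> 0).
{ intros E. assert (T : RtoC 3 = 0).
  { transitivity (- ((- (1) - w - w) * (- (1) - w - w))); [ring [Hw] | rewrite E; ring]. }
  apply RtoC_inj in T. lra. }
assert (D : d = lincomb (- (1)) b (- (1)) c).
{ assert (X := H (RtoC 1, RtoC 0)). assert (Y := H (RtoC 0, RtoC 1)).
  assert (Z := H (RtoC 1, RtoC 1)).
  clear - X Y Z. revert X Y Z.
  destruct b as [[a1 a2] [b1 b2] [p1 p2]], c as [[d1 d2] [e1 e2] [q1 q2]],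
    d as [[f1 f2] [g1 g2] [r1 r2]]. rewrite !bil_pair.
  unfold lincomb, addv, scalev, zerov. cbn [fst snd xx xy yy].
  intros X Y Z.
  assert (X1 := f_equal fst X : _ = RtoC 0). assert (X2 := f_equal snd X : _ = RtoC 0).
  assert (Y1 := f_equal fst Y : _ = RtoC 0). assert (Y2 := f_equal snd Y : _ = RtoC 0).
  assert (Z1 := f_equal fst Z : _ = RtoC 0). assert (Z2 := f_equal snd Z : _ = RtoC 0).
  cbn [fst snd] in *. clear X Y Z.
  (* Polarization: the value at (1, 1) minus those at (1, 0) and (0, 1) is twice the mixed
     coefficient. *)
  assert (E : forall b c d x y z : C, x = 0 -> y = 0 -> z = 0 ->
     z - x - y = 2 * (b + c + d) -> d = - (1) * b + - (1) * c).
  { clear. intros b c d x y z -> -> -> H. cnsatz. }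
  f_equal; f_equal.
  - clear - X1. nsatz.
  - clear - X2. nsatz.
  - apply (E _ _ _ _ _ _ X1 Y1 Z1). ring.
  - apply (E _ _ _ _ _ _ X2 Y2 Z2). ring.
  - clear - Y1. nsatz.
  - clear - Y2. nsatz. }
subst d.
(* Solved from (w^2 - w) U = w^2 X_1 - X_2 and (w^2 - w) V = X_2 - w X_1. *)
exists (lincomb ((- (1) - w) / (- (1) - w - w)) b (- (1) / (- (1) - w - w)) c),
  (lincomb (- w / (- (1) - w - w)) b (1 / (- (1) - w - w)) c).
destruct b as [[a1 a2] [b1 b2] [p1 p2]], c as [[d1 d2] [e1 e2] [q1 q2]].
unfold twisted, lincomb, addv, scalev. cbn [fst snd xx xy yy].
repeat split; f_equal; f_equal; field; intros E; apply N; rewrite <- E; ring.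
Qed.

(** * Passage between vector fields and their coefficients *)

Ltac in_C :=
  repeat match goal with |- context [@plus ?T ?x ?y] => change (@plus T x y) with (Cplus x y) end;
  match goal with |- ?x = ?y => change (@eq C x y) end.

Lemma homogeneous2_bil (X : vfield) :
  homogeneous 2 X -> exists b, forall z : C * C, X z = bil b z z.
Proof.
intros [[c Hc] [d Hd]].
(* Index i counts the power of x, so index 2 gives x^2; the mixed coefficient is halved. *)
exists (SymBil (c 2%nat, d 2%nat) (c 1%nat / 2, d 1%nat / 2) (c 0%nat, d 0%nat)).
assert (N : RtoC 2 <> 0) by (apply RtoC_neq_0; lra).
intros [x y]. rewrite bil_pair. rewrite (surjective_pairing (X (x, y))).
specialize (Hc x y). specialize (Hd x y). cbn [fst snd] in *.
f_equal; [rewrite Hc|rewrite Hd]; rewrite !sum_Sn, sum_O;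
  cbn [Nat.sub Cpow]; in_C; field; exact N.
Qed.

Lemma coords_linear_change e f : det e f <> 0 -> linear_change (coords e f).
Proof.
intros D. split.
- assert (L : forall a b : C, is_linear (U := C2) (V := C_NormedModule)
     (fun z => plus (scal a (fst z)) (scal b (snd z)))).
  { intros a b.
    apply (is_linear_comp (fun z : C2 => (scal a (fst z), scal b (snd z)))
             (fun z => plus (fst z) (snd z))); [|apply is_linear_plus].
    apply (is_linear_prod (V := C_NormedModule)).
    - exact (is_linear_comp (U := C2) _ _ is_linear_fst
        (is_linear_scal_r (V := C_NormedModule) a Cmult_comm)).
    - exact (is_linear_comp (U := C2) _ _ is_linear_snd
        (is_linear_scal_r (V := C_NormedModule) b Cmult_comm)). }
  (* The inverse of the matrix with columns e and f. *)
  apply (is_linear_ext (fun z : C2 =>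
    (plus (scal (snd f / det e f) (fst z)) (scal (- fst f / det e f) (snd z)),
     plus (scal (- snd e / det e f) (fst z)) (scal (fst e / det e f) (snd z))) : C2));
   [|apply (is_linear_prod (V := C_NormedModule)); apply L].
  intros [x y]. unfold coords.
  change (@scal _ C_NormedModule) with Cmult.
  generalize (Cinv_neq_0 _ D). unfold Cdiv. generalize (/ det e f). intros k _.
  destruct e as [e1 e2], f as [f1 f2]. unfold det. cbn [fst snd].
  f_equal; in_C; ring.
- exists (combine e f). split; intros z; [now apply combine_coords|now apply coords_combine].
Qed.

Lemma bil_shear u z : bil (shear u) z z = ay2dx u z.
Proof.
destruct z as [x y]. unfold shear, zerov. rewrite bil_pair. unfold ay2dx. cbn [fst snd].
f_equal; ring.
Qed.

Theorem theorem7 :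
  forall X : nat -> vfield,
    homogeneous_chambar 3 2 X ->
    (exists (L : C2 -> C2) (a : nat -> C),
      linear_change L /\
      (a 1%nat + a 2%nat + a 3%nat = 0)%C /\
      forall i, (1 <= i <= 3)%nat -> written_as L (X i) (ay2dx (a i))) /\
    rigid 3 X.
Proof.
intros X [(Hol & Nz & _ & Bar) Hom].
destruct (homogeneous2_bil _ (Hom 1%nat ltac:(lia))) as [b1 E1].
destruct (homogeneous2_bil _ (Hom 2%nat ltac:(lia))) as [b2 E2].
destruct (homogeneous2_bil _ (Hom 3%nat ltac:(lia))) as [b3 E3].
pose (B k := match k with 1%nat => b1 | 2%nat => b2 | _ => b3 end).
assert (HX : forall k, (1 <= k <= 3)%nat -> forall z, X k z = bil (B k) z z)
  by (intros [|[|[|[|k]]]] Hk; try lia; assumption).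
assert (J := barycentric_jet X B HX Bar).
destruct cube_root_of_unity as [w Hw].
destruct (twisted_exists w b1 b2 b3 Hw (fun z => proj1 (J z))) as (u & v & T1 & T2 & T3).
assert (T : forall k, (1 <= k <= 3)%nat -> B k = twisted w u v k)
  by (intros [|[|[|[|k]]]] Hk; try lia; assumption).
destruct (simultaneous_shear_of_order23 u v) as (e & f & p & q & D & U & V).
{ apply (twisted_order2 w _ _ Hw). intros z. rewrite <- (proj1 (proj2 (J z))).
  unfold sum3. rewrite !T by lia. reflexivity. }
{ apply (twisted_order3 w _ _ Hw). intros z. rewrite <- (proj2 (proj2 (J z))).
  unfold sum3. rewrite !T by lia. reflexivity. }
(* The shear coefficients of U and V recombined as in [twisted]; they sum to zero because 1 + w +
   w^2 = 0. *)
pose (a k := match k with 1%nat => 1 * p + 1 * q | 2%nat => w * p + (- (1) - w) * q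
  | _ => (- (1) - w) * p + w * q end).
assert (W : forall k, (1 <= k <= 3)%nat -> written_as (coords e f) (X k) (ay2dx (a k))).
{ intros k Hk z. rewrite (HX k Hk), <- bil_shear.
  rewrite <- (combine_coords e f z D) at 1 2. rewrite <- bil_in_frame, T by exact Hk. f_equal.
  destruct k as [|[|[|[|k]]]]; try lia; unfold twisted;
    now rewrite in_frame_lincomb, U, V, lincomb_shear. }
split.
- exists (coords e f), a. split; [now apply coords_linear_change|].
  split; [cbv beta iota delta [a]; ring|exact W].
(* All three fields are multiples of one field along e. Since X_1 is not identically zero, a_1 <> 0,
   and X_1 itself can serve as the common field, with its holomorphy given. *)
- assert (E : forall k, (1 <= k <= 3)%nat -> forall z, X k z = scalev (a k * snd (coords e f z) ^ 2) e).
  { intros k Hk z. rewrite <- (combine_coords e f (X k z) D). rewrite (W k Hk z).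
    destruct (coords e f z). unfold combine, ay2dx, addv, scalev. cbn [fst snd]. f_equal; ring. }
  assert (N : a 1%nat <> 0).
  { intros Z. destruct (Nz 1%nat ltac:(lia)) as [z Hz]. apply Hz.
    rewrite (E 1%nat ltac:(lia)), Z. unfold scalev. apply injective_projections; cbn [fst snd];
    rewrite !Cmult_0_l; reflexivity. }
  exists (X 1%nat), (fun k => a k / a 1%nat). split; [apply Hol; lia|].
  intros k Hk z. rewrite (E k Hk), (E 1%nat ltac:(lia)). change (@scal _ C2) with scalev.
  unfold scalev. cbn [fst snd]. f_equal; field; exact N.
Qed.
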